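(* Let $\mathcal F$ be a singular foliation on a connected manifold $M$ such that every point of $M$ has a neighborhood on which $\mathcal F$ admits a geometric resolution of finite length. Then all regular leaves of $\mathcal F$ have the same dimension $r$. Moreover, for every geometric resolution of finite length $(E,\mathrm d,\rho)$ of $\mathcal F$ over a (non-empty) open subset of $M$, $$r=\sum_{i\ge1}(-1)^{i-1}\operatorname{rk}(E_{-i}),$$ where $\operatorname{rk}$ denotes the rank of a vector bundle.
   Context: $M$ is a smooth, real analytic, or complex manifold, $\mathscr O$ the corresponding sheaf of functions, $\Gamma(\cdot)$ sheaves of sections in that category. A singular foliation is a subsheaf $\mathcal F$ of the sheaf of vector fields consisting of $\mathscr O$-modules, closed under Lie bracket and locally finitely generated (each $m$ has an open neighborhood $U_m$ and finitely many elements of $\mathcal F(U_m)$ whose restrictions generate $\mathcal F(V)$ for every open $V\subset U_m$). Leaves of $\mathcal F$: the maximal connected (immersed) submanifolds $N$ with $T_xN=\{X(x):X\in\mathcal F\}$ for all $x\in N$; they partition $M$. Let $r_x=\dim\{X(x):X\in\mathcal F\}$. A point is regular if $x\mapsto r_x$ is constant near it, singular otherwise; a leaf containing one regular point consists of regular points only and is then called regular. A geometric resolution $(E,\mathrm d,\rho)$ of $\mathcal F$ consists of vector bundles $E_{-i}$, $i\ge1$, vector bundle morphisms $\mathrm d^{(i)}:E_{-i}\to E_{-i+1}$ ($i\ge2$) and $\rho:E_{-1}\to TM$ over the identity, such that $\cdots\to\Gamma(E_{-2})\xrightarrow{\mathrm d^{(2)}}\Gamma(E_{-1})\xrightarrow{\rho}\mathcal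 F\to0$ is an exact sequence of sheaves. It is of finite length if $E_{-i}=0$ for all large $i$. *)

(* Defs.v *)
From HB Require Import structures.
From mathcomp Require Import all_boot all_order all_algebra.
From mathcomp Require Import all_classical all_reals all_analysis.
From mathcomp Require Import complex.
Set Implicit Arguments.
Unset Strict Implicit.
Unset Printing Implicit Defensive.
Import Order.TTheory GRing.Theory Num.Theory numFieldNormedType.Exports.
Local Open Scope classical_set_scope.
Local Open Scope ring_scope.

(** * The three categories of functions on open subsets of [K^n] *)

Section FunctionClasses.
Variables (K : numFieldType) (n : nat).
Implicit Types (D : set 'rV[K]_n) (f : 'rV[K]_n -> K^o).

Fixpoint Ck (k : nat) D f : Prop :=
  match k with
  | 0 => forall p, D p -> {for p, continuous f}
  | k'.+1 => (forall p, D p -> differentiable f p) /\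
             (forall v, Ck k' D (fun p => 'D_v f p))
  end.

Definition smooth_on D f : Prop := forall k, Ck k D f.

(* The sum of [c a * h ^ a] over the multi-indices [a] in [{0, .., N-1}^n]. *)
Definition power_sum (c : {ffun 'I_n -> nat} -> K) (h : 'rV[K]_n) (N : nat) : K :=
  \sum_(a : {ffun 'I_n -> 'I_N})
     c [ffun i => nat_of_ord (a i)] * \prod_(i < n) h 0 i ^+ a i.

(* Near [p], [f] is the sum of a power series that converges absolutely on a
   closed polydisc of radius [e > 0] around [p]. *)
Definition analytic_at f (p : 'rV[K]_n) : Prop :=
  exists (c : {ffun 'I_n -> nat} -> K) (e B : K),
    [/\ 0 < e,
        forall N, power_sum (fun a => `|c a|) (const_mx e) N <= B
      & forall h : 'rV[K]_n, (forall i, `|h 0 i| <= e) ->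
          power_sum c h @ \oo --> f (p + h)].

Definition analytic_on D f : Prop := forall p, D p -> analytic_at f p.

(* On an open subset of [C^n], with [K = C] as the field of scalars. *)
Definition holomorphic_on D f : Prop := forall p, D p -> differentiable f p.

End FunctionClasses.

Variant geometry := Smooth | RealAnalytic | Holomorphic.

Definition scalars (R : realType) (g : geometry) : numFieldType :=
  match g with
  | Smooth => R
  | RealAnalytic => R
  | Holomorphic => R[i]
  end.

Definition class_on (R : realType) (g : geometry) (n : nat) :
    set 'rV[scalars R g]_n -> ('rV[scalars R g]_n -> scalars R g) -> Prop :=
  match g return
    set 'rV[scalars R g]_n -> ('rV[scalars R g]_n -> scalars R g) -> Prop with
  | Smooth => @smooth_on R n
  | RealAnalytic => @analytic_on R n
  | Holomorphic => @holomorphic_on R[i] n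
  end.

(* Maps between open subsets of [K^m] and [K^n], componentwise. *)
Definition class_map_on (R : realType) (g : geometry) (m n : nat)
    (D : set 'rV[scalars R g]_m)
    (f : 'rV[scalars R g]_m -> 'rV[scalars R g]_n) : Prop :=
  forall j, class_on D (fun p => f p 0 j).

(** * Manifolds *)

(* [cmap] and [cinv] are total functions; their values outside [cdom] and
   outside its image are irrelevant. *)
Record chart (K : numFieldType) (n : nat) (T : topologicalType) := Chart {
  cdom : set T;
  cmap : T -> 'rV[K]_n;
  cinv : 'rV[K]_n -> T;
  cdom_open : open cdom;
  cimg_open : open (cmap @` cdom);
  cmapK : forall x, cdom x -> cinv (cmap x) = x;
  cmap_cont : forall x, cdom x -> {for x, continuous cmap};
  cinv_cont : forall p, (cmap @` cdom) p -> {for p, continuous cinv}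
}.

(* Manifolds of pure dimension [n] over [K] (so complex dimension in the
   holomorphic case), presented by an atlas that need not be maximal.
   [chart_at x] is a preferred chart at [x]; it serves to identify the tangent
   space at [x] with [K^n]. *)
Record manifold (R : realType) (g : geometry) (n : nat) := Manifold {
  carrier :> topologicalType;
  carrier_hausdorff : hausdorff_space carrier;
  carrier_second_countable : @second_countable carrier;
  atlas : set (chart (scalars R g) n carrier);
  chart_at : carrier -> chart (scalars R g) n carrier;
  chart_at_atlas : forall x, atlas (chart_at x);
  chart_at_dom : forall x, cdom (chart_at x) x;
  atlas_compat : forall c c', atlas c -> atlas c' ->
    class_map_on (cmap c @` (cdom c `&` cdom c')) (cmap c' \o cinv c)
}.
Arguments atlas {R g n} m.
Arguments chart_at {R g n} m x.

Section Manifolds.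
Variables (R : realType) (g : geometry).
Let K := scalars R g.

(* [structure_sheaf V f]: [f] restricts to a section over [V] of the sheaf
   [O] of [M]. *)
Definition structure_sheaf n (M : manifold R g n) (V : set M) (f : M -> K) : Prop :=
  forall c, atlas M c -> class_on (cmap c @` (V `&` cdom c)) (f \o cinv c).

Definition manifold_map k n (N : manifold R g k) (M : manifold R g n)
    (f : N -> M) : Prop :=
  continuous f /\
  forall c c', atlas N c -> atlas M c' ->
    class_map_on (cmap c @` (cdom c `&` f @^-1` cdom c')) (cmap c' \o f \o cinv c).

(* The tangent map at [y], the tangent spaces at [y] and [f y] being identified
   with [K^k] and [K^n] by the preferred charts. *)
Definition tangent_map k n (N : manifold R g k) (M : manifold R g n)
    (f : N -> M) (y : N) : 'rV[K]_k -> 'rV[K]_n :=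
  'd (cmap (chart_at M (f y)) \o f \o cinv (chart_at N y))
     (cmap (chart_at N y) y).

(* The coordinates in the chart [c] of a tangent vector [v] at [x]. *)
Definition tangent_coord n (M : manifold R g n) (c : chart K n M) (x : M)
    (v : 'rV[K]_n) : 'rV[K]_n :=
  'd (cmap c \o cinv (chart_at M x)) (cmap (chart_at M x) x) v.

(** * Vector bundles *)

(* A family of vector spaces with a family of maps [triv a x] from the fibres
   to [K^rk]. The axioms that make it a vector bundle of rank [rk] over an open
   set [U] are in [vector_bundle] below. The values over points outside [U] or
   outside [tdom a] are irrelevant. *)
Record bundle_data n (M : manifold R g n) := BundleData {
  fib : M -> lmodType K;
  rk : nat;
  tindex : Type;
  tdom : tindex -> set M;
  triv : tindex -> forall x, fib x -> 'rV[K]_rk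
}.

Section Bundles.
Variables (n : nat) (M : manifold R g n).
Implicit Types (U V W : set M) (E : bundle_data M).

(* A family of maps between fibres that, in local trivializations, is given by
   matrices with entries in [O] (acting on row vectors). *)
Definition class_family U E (E' : bundle_data M) (phi : forall x, fib E x -> fib E' x) : Prop :=
  forall (a : tindex E) (b : tindex E'),
  exists h : M -> 'M[K]_(rk E, rk E'),
    (forall i j,
       structure_sheaf (U `&` tdom a `&` tdom b) (fun x => h x i j)) /\
    (forall x, (U `&` tdom a `&` tdom b) x -> forall e : fib E x,
       triv b (phi x e) = triv a e *m h x).

Definition bundle_morphism U E (E' : bundle_data M)
    (phi : forall x, {linear fib E x -> fib E' x}) : Prop :=
  class_family U (fun x => phi x : fib E x -> fib E' x).

(* The matrices of the identity are the transition functions. *)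
Definition vector_bundle U E : Prop :=
  [/\ forall a : tindex E, open (tdom a),
      forall x, U x -> exists a : tindex E, tdom a x,
      forall (a : tindex E) x, (U `&` tdom a) x ->
        linear (@triv _ _ E a x) /\ bijective (@triv _ _ E a x)
    & class_family U (fun x (e : fib E x) => e)].

Definition is_section V E (s : forall x, fib E x) : Prop :=
  forall (a : tindex E) j,
    structure_sheaf (V `&` tdom a) (fun x => triv a (s x) 0 j).

(* The tangent bundle [TM], trivialized by the charts of the atlas. *)
Definition tangent : bundle_data M :=
  @BundleData n M (fun _ => 'rV[K]_n) n {c | atlas M c}
    (fun c => cdom (proj1_sig c)) (fun c x v => tangent_coord (proj1_sig c) x v).

Definition vector_field V (X : M -> 'rV[K]_n) : Prop := @is_section V tangent X.

Definition in_chart (c : chart K n M) (X : M -> 'rV[K]_n) (p : 'rV[K]_n) :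
    'rV[K]_n :=
  tangent_coord c (cinv c p) (X (cinv c p)).

Definition lie_bracket (X Y : M -> 'rV[K]_n) (x : M) : 'rV[K]_n :=
  let c := chart_at M x in
  let p := cmap c x in
  'D_(in_chart c X p) (in_chart c Y) p - 'D_(in_chart c Y p) (in_chart c X) p.

(** * Singular foliations *)

(* A family [F] of sets of vector fields: [F V X] means that [X] restricts to
   an element of [F(V)]. Vector fields over [V] are represented by functions
   on [M] whose values outside [V] are irrelevant ([fol_ext]). *)
Record singular_foliation (F : set M -> set (M -> 'rV[K]_n)) : Prop := {
  fol_vector_field : forall V X, open V -> F V X -> vector_field V X;
  fol_ext : forall V X Y, open V -> {in V, X =1 Y} -> F V X -> F V Y;
  fol_restrict : forall V W X, open V -> open W -> W `<=` V -> F V X -> F W X;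
  fol_glue : forall (C : set (set M)) X,
    (forall V, C V -> open V /\ F V X) -> F (\bigcup_(V in C) V) X;
  fol0 : forall V, open V -> F V (fun=> 0);
  folD : forall V X Y, open V -> F V X -> F V Y -> F V (fun x => X x + Y x);
  folZ : forall V f X, open V -> structure_sheaf V f -> F V X ->
    F V (fun x => f x *: X x);
  fol_bracket : forall V X Y, open V -> F V X -> F V Y -> F V (lie_bracket X Y);
  fol_fin_gen : forall m : M, exists U, [/\ open U, U m &
    exists (k : nat) (X : 'I_k -> M -> 'rV[K]_n),
      (forall i, F U (X i)) /\
      (forall V Y, open V -> V `<=` U -> F V Y ->
         exists f : 'I_k -> M -> K,
           (forall i, structure_sheaf V (f i)) /\
           (forall x, V x -> Y x = \sum_(i < k) f i x *: X i x))]
}.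

Implicit Type F : set M -> set (M -> 'rV[K]_n).

(* The subspace [{X(x) : X in F}] of the tangent space at [x]. *)
Definition fol_at F (x : M) : set 'rV[K]_n :=
  [set v | exists V X, [/\ open V, V x, F V X & X x = v]].

Definition has_dim (S : set 'rV[K]_n) (r : nat) : Prop :=
  exists A : 'M[K]_(r, n), row_free A /\ S = [set v | (v <= A)%MS].

Definition regular_point F (x : M) : Prop :=
  exists r V, [/\ open V, V x & forall y, V y -> has_dim (fol_at F y) r].

(* A connected immersed submanifold, presented as the image of an injective
   immersion [i], whose tangent spaces are those of [F]. *)
Definition integral_submanifold F k (N : manifold R g k) (i : N -> M) : Prop :=
  [/\ [set: N] !=set0 /\ connected [set: N],
      manifold_map i,
      injective i,
      forall y, injective (tangent_map i y)
    & forall y, range (tangent_map i y) = fol_at F (i y)].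

Definition leaf F k (N : manifold R g k) (i : N -> M) : Prop :=
  integral_submanifold F i /\
  forall k' (N' : manifold R g k') (i' : N' -> M),
    integral_submanifold F i' -> range i `<=` range i' -> range i' = range i.

Definition regular_leaf F k (N : manifold R g k) (i : N -> M) : Prop :=
  leaf F i /\ exists y, regular_point F (i y).

(** * Geometric resolutions *)

(* [res_E i] is the bundle [E_{-(i+1)}] and [res_d i] is the map
   [d^(i+2) : E_{-(i+2)} -> E_{-(i+1)}]. Exactness is that of sheaves:
   sections are lifted locally. *)
Record geometric_resolution F U := GeometricResolution {
  res_E : nat -> bundle_data M;
  res_d : forall i x, {linear fib (res_E i.+1) x -> fib (res_E i) x};
  res_rho : forall x, {linear fib (res_E 0) x -> fib tangent x};
  res_bundle : forall i, vector_bundle U (res_E i);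
  res_d_morphism : forall i, bundle_morphism U (res_d i);
  res_rho_morphism : bundle_morphism U res_rho;
  res_rho_in : forall V s, open V -> V `<=` U -> is_section V s ->
    F V (fun x => res_rho x (s x));
  res_rho_surj : forall V X, open V -> V `<=` U -> F V X ->
    forall x, V x -> exists W s, [/\ open W, W x, W `<=` V, is_section W s &
      forall y, W y -> res_rho y (s y) = X y];
  res_exact_rho : forall V (s : forall x, fib (res_E 0) x),
    open V -> V `<=` U -> is_section V s ->
    (forall x, V x -> res_rho x (s x) = 0) <->
    (forall x, V x -> exists W t, [/\ open W, W x, W `<=` V, is_section W t &
       forall y, W y -> res_d 0 y (t y) = s y]);
  res_exact_d : forall i V (s : forall x, fib (res_E i.+1) x),
    open V -> V `<=` U -> is_section V s ->
    (forall x, V x -> res_d i x (s x) = 0) <->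
    (forall x, V x -> exists W t, [/\ open W, W x, W `<=` V, is_section W t &
       forall y, W y -> res_d i.+1 y (t y) = s y])
}.

(* [E_{-i} = 0] for all [i > L]. *)
Definition length_le F U (E : geometric_resolution F U) (L : nat) : Prop :=
  forall i, (L <= i)%N -> rk (res_E E i) = 0%N.

Definition finite_length F U (E : geometric_resolution F U) : Prop :=
  exists L, length_le E L.

End Bundles.
End Manifolds.

(* Main.v *)
(* Call a point generic for a finite resolution when the ranks of all the maps
   [d^(i)] and of [rho] are constant around it. Ranks are lower semicontinuous
   and bounded, so generic points are dense. At a generic point every vector in
   the kernel of a map extends to a local section of that kernel, which lifts by
   exactness of the sheaves of sections; hence the complex of fibres is exact
   there and the dimension of the foliation is the alternating sum of the ranks.
   Thus this sum is the dimension of [F] on a dense set of points, so that two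
   resolutions with overlapping domains have the same alternating sum, and it is
   constant by connectedness. The dimension of a regular leaf is the dimension
   of [F] around any of its regular points, some of which are generic. *)
Require Import Defs.
From HB Require Import structures.
From mathcomp Require Import all_boot all_order all_algebra.
From mathcomp Require Import all_classical all_reals all_analysis.
From mathcomp Require Import complex zify.
Import Order.TTheory GRing.Theory Num.Theory numFieldNormedType.Exports.
Local Open Scope classical_set_scope.
Local Open Scope ring_scope.
Set Implicit Arguments.
Unset Strict Implicit.
Unset Printing Implicit Defensive.

(** * Smooth functions *)

(** The first-order expansion at [p] depends only on the germ: it passes to [g], and uniqueness of
    the differential identifies ['d g p] with [df]. *)
Lemma near_eq_is_diff (K : numFieldType) (V W : normedModType K)
    (f g : V -> W) (p : V) (df : {linear V -> W}) :
  {near p, f =1 g} -> is_diff p f df -> is_diff p g df.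
Proof.
move=> fg [dfp dfE].
have cdf : continuous df by rewrite -dfE; exact: diff_continuous.
have gE : g \o shift p = cst (g p) + df +o_ 0 id.
  apply/eqaddoP => e e0.
  have /eqaddoP/(_ e e0) := diff_locally dfp.
  have fg' : \forall q \near p, f q = g q := fg.
  rewrite (near_shift (0 : V)) subr0 in fg'.
  rewrite dfE; apply: filterS2 fg'.
  move=> h /= fgh; rewrite !fctE /= fgh -(nbhs_singleton fg).
  by rewrite /cst.
have dgE := diff_unique cdf gE.
apply: DiffDef => //; apply/diff_locallyP; rewrite dgE; split=> //.
Qed.

Lemma near_eq_differentiable (K : numFieldType) (V W : normedModType K)
    (f g : V -> W) (p : V) :
  {near p, f =1 g} -> differentiable f p -> differentiable g p.
Proof.
by move=> fg /differentiableP df; have [] := near_eq_is_diff fg df.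
Qed.

Section Smooth.
Variables (K : numFieldType) (n : nat).
Implicit Types (D : set 'rV[K]_n) (f g : 'rV[K]_n -> K^o).

Lemma Ck_eq k D f g : open D -> {in D, f =1 g} -> Ck k D f -> Ck k D g.
Proof.
move=> oD; elim: k f g => [|k IH] f g fg /=.
  move=> cf p Dp.
  have npf : {near p, f =1 g}.
    by apply: filterS (open_nbhs_nbhs (conj oD Dp)) => q /mem_set /fg.
  have fgp : f p = g p := nbhs_singleton npf.
  have : f @ p --> f p := cf p Dp.
  suff : f @ p --> g p -> g @ p --> g p by rewrite fgp.
  apply: cvg_trans; apply: (@near_eq_cvg _ _ (nbhs p)).
  by apply: filterS (open_nbhs_nbhs (conj oD Dp)) => q /mem_set /fg.
move=> [df Cf]; split=> [p Dp|v].
  apply: near_eq_differentiable (df p Dp).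
  by apply: filterS (open_nbhs_nbhs (conj oD Dp)) => q /mem_set /fg.
apply: IH (Cf v) => p /set_mem Dp; apply: near_eq_derive.
by apply: filterS (open_nbhs_nbhs (conj oD Dp)) => q /mem_set /fg.
Qed.

Lemma CkS k D f : Ck k.+1 D f -> Ck k D f.
Proof.
elim: k f => [|k IH] f [df Cf].
  by move=> p Dp; apply: differentiable_continuous; apply: df.
by split=> // v; apply: IH.
Qed.

Lemma Ck_subset k D D' f : D' `<=` D -> Ck k D f -> Ck k D' f.
Proof.
move=> sD; elim: k f => [|k IH] f /=; first by move=> cf p /sD; apply: cf.
move=> [df Cf]; split=> [p /sD|v]; [exact: df | exact: (IH _ (Cf v))].
Qed.

Lemma Ck_cst k D (a : K) : Ck k D (fun=> a).
Proof.
elim: k a => [|k IH] a /=; first by move=> p _; exact: (@cst_continuous _ K^o a).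
split=> [p _|v]; first exact: (differentiable_cst (a : K^o) p).
suff -> : (fun p => 'D_v (fun=> a : K^o) p) = fun=> 0 by apply: IH.
by apply/funext => p; exact: (@derive_cst _ _ (K^o) a p v).
Qed.

Lemma CkD k D f g : open D -> Ck k D f -> Ck k D g -> Ck k D (f + g).
Proof.
move=> oD; elim: k f g => [|k IH] f g /=.
  by move=> cf cg p Dp; exact: continuousD (cf p Dp) (cg p Dp).
move=> [df Cf] [dg Cg]; split=> [p Dp|v].
  by apply: differentiableD; [apply: df | apply: dg].
apply: Ck_eq (IH _ _ (Cf v) (Cg v)) => // p /set_mem Dp.
by rewrite deriveD //; apply: diff_derivable; [apply: df | apply: dg].
Qed.

Lemma CkM k D f g : open D -> Ck k D f -> Ck k D g -> Ck k D (f * g).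
Proof.
move=> oD; elim: k f g => [|k IH] f g.
  by move=> cf cg p Dp; exact: continuousM (cf p Dp) (cg p Dp).
move=> Cf Cg; have [df dCf] := Cf; have [dg dCg] := Cg; split=> [p Dp|v].
  by apply: differentiableM; [apply: df | apply: dg].
(* The Leibniz rule gives [f * 'D_v g + g * 'D_v f]; [CkS] lowers the order of [f] and [g] to that
   of their derivatives, so that the induction hypothesis applies to both products. *)
have := CkD oD (IH _ _ (CkS Cf) (dCg v)) (IH _ _ (CkS Cg) (dCf v)).
apply: Ck_eq => // p /set_mem Dp.
by rewrite deriveM //; apply: diff_derivable; [apply: df | apply: dg].
Qed.

End Smooth.

(** * Analytic functions *)

Lemma ler_sum_subset (R : numDomainType) (T : eqType) (s1 s2 : seq T) (F : T -> R) :
  uniq s1 -> uniq s2 -> {subset s1 <= s2} -> (forall x, 0 <= F x) ->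
  \sum_(x <- s1) F x <= \sum_(x <- s2) F x.
Proof.
move=> u1 u2 s12 F0; rewrite [leRHS](bigID (mem s1)) /= -[leLHS]addr0.
apply: lerD; last exact: sumr_ge0.
rewrite -[leRHS]big_filter (perm_big [seq x <- s2 | x \in s1]) //.
apply: uniq_perm => //; first exact: filter_uniq.
by move=> x; rewrite mem_filter /=; case: (boolP (x \in s1)) => //= /s12 ->.
Qed.

(** * Multi-indices and absolutely convergent power series *)

Section MultiIndex.
Variable n : nat.
Local Notation idx := {ffun 'I_n -> nat}.

(** The functions to ['I_N] are moved into one type independent of [N], in which cubes of different
    sides can be compared and indices added. *)
Definition cube (N : nat) : seq idx :=
  [seq [ffun i => nat_of_ord (a i)] | a : {ffun 'I_n -> 'I_N}].

Lemma mem_cube N (m : idx) : (m \in cube N) = [forall i, (m i < N)%N].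
Proof.
apply/mapP/forallP => [[a _ ->] i|mN]; first by rewrite ffunE.
exists [ffun i => Ordinal (mN i)]; first by rewrite mem_enum.
by apply/ffunP => i; rewrite !ffunE.
Qed.

Lemma uniq_cube N : uniq (cube N).
Proof.
rewrite map_inj_uniq ?enum_uniq // => a b /ffunP ab; apply/ffunP => i.
by apply/val_inj; have := ab i; rewrite !ffunE.
Qed.

Lemma cube_subset N N' : (N <= N')%N -> {subset cube N <= cube N'}.
Proof.
move=> NN m; rewrite !mem_cube => /forallP mN; apply/forallP => i.
exact: leq_trans (mN i) NN.
Qed.

Lemma mem_cubeD N N' (a b : idx) :
  a \in cube N -> b \in cube N' -> a + b \in cube (N + N').
Proof.
rewrite !mem_cube => /forallP aN /forallP bN; apply/forallP => i.
by rewrite ffunE; have := aN i; have := bN i; rewrite /GRing.add /=; lia.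
Qed.

Lemma cubeDl N (a b : idx) : a + b \in cube N -> a \in cube N.
Proof.
rewrite !mem_cube => /forallP abN; apply/forallP => i.
by have := abN i; rewrite ffunE /GRing.add /=; lia.
Qed.

Lemma cubeDr N (a b : idx) : a + b \in cube N -> b \in cube N.
Proof. by rewrite addrC => /cubeDl. Qed.

Definition cube2 N : seq (idx * idx) := [seq (a, b) | a <- cube N, b <- cube N].

Lemma mem_cube2 N (p : idx * idx) :
  (p \in cube2 N) = (p.1 \in cube N) && (p.2 \in cube N).
Proof.
apply/allpairsP/andP => [[q [q1 q2 ->]] //|[p1 p2]].
by exists p; split=> //; case: p {p1 p2}.
Qed.

Lemma uniq_cube2 N : uniq (cube2 N).
Proof. by apply: allpairs_uniq; try exact: uniq_cube; case=> ? ? [? ?]. Qed.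

Definition degree_bound (m : idx) : nat := (\sum_i m i).+1.

Lemma mem_cube_bound (m : idx) : m \in cube (degree_bound m).
Proof.
rewrite mem_cube; apply/forallP => i.
by rewrite /degree_bound ltnS (bigD1 i) //= leq_addr.
Qed.

Variable R : realType.
Implicit Types (c d : idx -> R) (h : 'rV[R]_n).

Definition monomial h (a : idx) : R := \prod_(i < n) h 0 i ^+ a i.

Lemma monomialD h (a b : idx) : monomial h (a + b) = monomial h a * monomial h b.
Proof.
by rewrite -big_split; apply: eq_bigr => i _; rewrite ffunE /= -exprD.
Qed.

Lemma monomial_const (t : R) (a : idx) :
  monomial (const_mx t) a = t ^+ (\sum_i a i).
Proof.
by rewrite -prodrXr; apply: eq_bigr => i _; rewrite mxE.
Qed.

Lemma monomial_const_ge0 (t : R) (a : idx) : 0 <= t -> 0 <= monomial (const_mx t) a.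
Proof. by move=> t0; rewrite monomial_const exprn_ge0. Qed.

Lemma norm_monomial_le h (t : R) (a : idx) : (forall i, `|h 0 i| <= t) ->
  `|monomial h a| <= monomial (const_mx t) a.
Proof.
move=> ht; rewrite /monomial normr_prod; apply: ler_prod => i _.
rewrite normr_ge0 normrX mxE /=; apply: lerXn2r; rewrite ?nnegrE //.
exact: le_trans (ht i).
Qed.

Lemma power_sumE c h N : power_sum c h N = \sum_(a <- cube N) c a * monomial h a.
Proof.
rewrite big_image /=; apply: eq_bigr => a _; congr (_ * _).
by apply: eq_bigr => i _; rewrite ffunE.
Qed.

Lemma power_sum_norm_le c h (t : R) N : (forall i, `|h 0 i| <= t) ->
  `|power_sum c h N| <= power_sum (fun a => `|c a|) (const_mx t) N.
Proof.
move=> ht; rewrite !power_sumE; apply: le_trans (ler_norm_sum _ _ _) _.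
apply: ler_sum => a _; rewrite normrM; apply: ler_wpM2l => //.
exact: norm_monomial_le.
Qed.

Lemma power_sum_homo c (t : R) : (forall a, 0 <= c a) -> 0 <= t ->
  {homo power_sum c (const_mx t) : N N' / (N <= N')%N >-> N <= N'}.
Proof.
move=> c0 t0 N N' NN; rewrite !power_sumE; apply: ler_sum_subset.
- exact: uniq_cube.
- exact: uniq_cube.
- exact: cube_subset.
- by move=> a; apply: mulr_ge0 => //; apply: monomial_const_ge0.
Qed.

Lemma power_sum_ge0 c (t : R) N : (forall a, 0 <= c a) -> 0 <= t ->
  0 <= power_sum c (const_mx t) N.
Proof.
move=> c0 t0; rewrite power_sumE; apply: sumr_ge0 => a _.
by apply: mulr_ge0 => //; apply: monomial_const_ge0.
Qed.

(** Coefficient of the product series. The cube of side [degree_bound m] only makes the sum finite;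
    by [cauchy_prodE] any cube that contains [m] gives the same value. *)
Definition cauchy_prod c d (m : idx) : R :=
  \sum_(p <- cube2 (degree_bound m) | p.1 + p.2 == m) c p.1 * d p.2.

Lemma cauchy_prodE c d m N : m \in cube N ->
  cauchy_prod c d m = \sum_(p <- cube2 N | p.1 + p.2 == m) c p.1 * d p.2.
Proof.
move=> mN; rewrite /cauchy_prod -[LHS]big_filter -[RHS]big_filter.
apply: perm_big; apply: uniq_perm.
- exact/filter_uniq/uniq_cube2.
- exact/filter_uniq/uniq_cube2.
move=> p; rewrite !mem_filter; case: eqP => //= pm; rewrite !mem_cube2.
have := mem_cube_bound m; rewrite -pm in mN * => pb.
by rewrite (cubeDl mN) (cubeDr mN) (cubeDl pb) (cubeDr pb).
Qed.

Lemma power_sumM_cube2 c d h N :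
  power_sum c h N * power_sum d h N =
  \sum_(p <- cube2 N) c p.1 * d p.2 * monomial h (p.1 + p.2).
Proof.
rewrite !power_sumE big_distrlr /= big_allpairs_dep /=.
by apply: eq_bigr => a _; apply: eq_bigr => b _; rewrite monomialD mulrACA.
Qed.

(** Pairs of indices are grouped by their sum. A sum inside the cube contributes to the Cauchy
    product; the pairs whose sum leaves the cube form the remainder. *)
Lemma power_sumM c d h N :
  power_sum c h N * power_sum d h N = power_sum (cauchy_prod c d) h N +
  \sum_(p <- cube2 N | p.1 + p.2 \notin cube N)
    c p.1 * d p.2 * monomial h (p.1 + p.2).
Proof.
rewrite power_sumM_cube2.
rewrite (bigID (fun p => p.1 + p.2 \in cube N)) /=; congr (_ + _).
rewrite power_sumE.
(* [cauchy_prodE] lets every inner sum run over the same set of pairs, so the two sums can be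
   exchanged; each pair then meets at most one [m]. *)
under [RHS]eq_big_seq => m mN do rewrite (cauchy_prodE c d mN) big_distrl /=.
rewrite (exchange_big_dep predT) //= [LHS]big_mkcond; apply: eq_bigr => p _.
rewrite (eq_bigl (pred1 (p.1 + p.2))); last by move=> m; rewrite /= eq_sym.
case: ifP => [pN|/negbT pN].
  by rewrite -big_filter filter_pred1_uniq ?uniq_cube // big_seq1.
rewrite big1_seq // => m /andP[/eqP -> mN].
by rewrite mN in pN.
Qed.

Lemma norm_cauchy_prod_le c d m :
  `|cauchy_prod c d m| <= cauchy_prod (fun a => `|c a|) (fun a => `|d a|) m.
Proof.
apply: le_trans (ler_norm_sum _ _ _) _.
by apply: ler_sum => p _; rewrite normrM.
Qed.

Lemma cauchy_prod_ge0 c d m : (forall a, 0 <= c a) -> (forall a, 0 <= d a) ->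
  0 <= cauchy_prod c d m.
Proof. by move=> c0 d0; apply: sumr_ge0 => p _; apply: mulr_ge0. Qed.

Section Nonneg.
Variables (c d : idx -> R) (t : R).
Hypotheses (c0 : forall a, 0 <= c a) (d0 : forall a, 0 <= d a) (t0 : 0 <= t).
Local Notation T := (const_mx t).

Lemma power_sum_cauchy_le N :
  power_sum (cauchy_prod c d) T N <= power_sum c T N * power_sum d T N.
Proof.
rewrite power_sumM lerDl; apply: sumr_ge0 => p _.
by rewrite mulr_ge0 ?monomial_const_ge0 // mulr_ge0.
Qed.

Lemma power_sum_cauchy_ge N :
  power_sum c T N * power_sum d T N <= power_sum (cauchy_prod c d) T (N + N).
Proof.
have G0 (p : idx * idx) : 0 <= c p.1 * d p.2 * monomial T (p.1 + p.2).
  by rewrite mulr_ge0 ?monomial_const_ge0 // mulr_ge0.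
rewrite power_sumM_cube2.
have -> : power_sum (cauchy_prod c d) T (N + N) =
    \sum_(p <- [seq p <- cube2 (N + N) | p.1 + p.2 \in cube (N + N)])
       c p.1 * d p.2 * monomial T (p.1 + p.2).
  have := power_sumM c d T (N + N).
  rewrite power_sumM_cube2.
  rewrite (bigID (fun p : idx * idx => p.1 + p.2 \in cube (N + N))) /=.
  by move/addIr <-; rewrite big_filter.
apply: ler_sum_subset => //.
- exact: uniq_cube2.
- exact/filter_uniq/uniq_cube2.
move=> p; rewrite mem_filter !mem_cube2 => /andP[p1 p2].
by rewrite mem_cubeD //= !(cube_subset (leq_addr _ _)).
Qed.

(* Monotone sequences: the cube of side [2N] contains every sum of two indices of
   the cube of side [N], so the partial sums of the Cauchy product converge to the
   product of the limits. *)
Lemma power_sum_cauchy_rest (A B : R) :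
  (forall N, power_sum c T N <= A) -> (forall N, power_sum d T N <= B) ->
  (fun N => power_sum c T N * power_sum d T N - power_sum (cauchy_prod c d) T N)
    @ \oo --> (0 : R).
Proof.
move=> cA dB.
have Acv : cvgn (power_sum c T).
  apply: nondecreasing_is_cvgn; first exact: power_sum_homo.
  by exists A => _ [N _ <-].
have Bcv : cvgn (power_sum d T).
  apply: nondecreasing_is_cvgn; first exact: power_sum_homo.
  by exists B => _ [N _ <-].
have P0 := fun a => cauchy_prod_ge0 a c0 d0.
have PcAB N : power_sum (cauchy_prod c d) T N <= A * B.
  apply: le_trans (power_sum_cauchy_le N) _.
  by apply: ler_pM; rewrite ?power_sum_ge0.
have Pcv : cvgn (power_sum (cauchy_prod c d) T).
  apply: nondecreasing_is_cvgn; first exact: power_sum_homo.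
  by exists (A * B) => _ [N _ <-].
have Mcv : (fun N => power_sum c T N * power_sum d T N) @ \oo -->
    limn (power_sum c T) * limn (power_sum d T) by apply: cvgM.
suff E : limn (power_sum (cauchy_prod c d) T) =
    limn (power_sum c T) * limn (power_sum d T).
  rewrite -(subrr (limn (power_sum (cauchy_prod c d) T))) {1}E.
  exact: cvgB.
apply/eqP; rewrite eq_le; apply/andP; split.
  apply: (ler_cvg_to Pcv Mcv); apply: nearW => N; exact: power_sum_cauchy_le.
apply: (ler_cvg_to Mcv (cvg_cst _)); apply: nearW => N.
apply: le_trans (power_sum_cauchy_ge N) _.
exact: nondecreasing_cvgn_le (power_sum_homo P0 t0) Pcv (N + N).
Qed.

End Nonneg.

(** The remainder in [power_sumM] is dominated termwise by the remainder for the absolute values at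
    [const_mx e], which tends to 0 by [power_sum_cauchy_rest]. *)
Lemma power_sum_cauchy_cvg c d h (e A B : R) (u v : R) :
  (forall i, `|h 0 i| <= e) -> 0 <= e ->
  (forall N, power_sum (fun a => `|c a|) (const_mx e) N <= A) ->
  (forall N, power_sum (fun a => `|d a|) (const_mx e) N <= B) ->
  power_sum c h @ \oo --> u -> power_sum d h @ \oo --> v ->
  power_sum (cauchy_prod c d) h @ \oo --> u * v.
Proof.
move=> he e0 cA dB cu dv.
have r0 := power_sum_cauchy_rest (fun a => normr_ge0 (c a))
  (fun a => normr_ge0 (d a)) e0 cA dB.
pose r N := power_sum c h N * power_sum d h N - power_sum (cauchy_prod c d) h N.
have -> : power_sum (cauchy_prod c d) h =
    (fun N => power_sum c h N * power_sum d h N - r N).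
  by apply/funext => N; rewrite /r opprB addrC subrK.
rewrite -[u * v]subr0; apply: cvgB; first exact: cvgM.
apply/norm_cvg0P; apply: (@squeeze_cvgr _ _ _ _ (fun=> 0)) r0; last exact: cvg_cst.
apply: nearW => N; rewrite normr_ge0 /r !power_sumM /=.
rewrite ![_ + \sum_(_ <- _ | _) _ - _]addrAC.
rewrite !subrr !add0r; apply: le_trans (ler_norm_sum _ _ _) _.
apply: ler_sum => p _; rewrite !normrM; apply: ler_wpM2l; first exact: mulr_ge0.
exact: norm_monomial_le.
Qed.

(** Serves to bring two expansions onto a common polydisc with unchanged coefficients and bounds. *)
Lemma analytic_at_shrink c (f : 'rV[R]_n -> R) p (e e' B : R) : 0 < e' <= e ->
  (forall N, power_sum (fun a => `|c a|) (const_mx e) N <= B) ->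
  (forall h, (forall i, `|h 0 i| <= e) -> power_sum c h @ \oo --> f (p + h)) ->
  (forall N, power_sum (fun a => `|c a|) (const_mx e') N <= B) /\
  (forall h, (forall i, `|h 0 i| <= e') -> power_sum c h @ \oo --> f (p + h)).
Proof.
move=> /andP[e'0 e'e] cB cf; split=> [N|h he]; last first.
  by apply: cf => i; apply: le_trans (he i) e'e.
apply: le_trans (cB N).
have normcK : (fun a => `| `|c a| |) = (fun a => `|c a|).
  by apply/funext => a; rewrite normr_id.
have := @power_sum_norm_le (fun a => `|c a|) (const_mx e') e N.
rewrite normcK => H; apply: le_trans (H _); first exact: ler_norm.
by move=> i; rewrite mxE ger0_norm // ltW.
Qed.

Lemma analytic_at_eq (f g : 'rV[R]_n -> R^o) p :
  {near p, f =1 g} -> analytic_at f p -> analytic_at g p.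
Proof.
move=> /nbhs_ballP[r /= r0 rfg] [c [e [B [e0 cB cf]]]].
(* Half of [r], since the polydisc is closed and the ball of radius [r] is open. *)
pose e' := Num.min e (r / 2).
have e'0 : 0 < e' by rewrite lt_min e0 /= divr_gt0.
have e'e : 0 < e' <= e by rewrite e'0 ge_min lexx.
have [cB' cf'] := analytic_at_shrink e'e cB cf.
exists c, e', B; split=> // h he; rewrite -rfg; first exact: cf'.
split=> // i j; rewrite !mxE ord1 /ball /= opprD addrA subrr sub0r normrN.
apply: le_lt_trans (he j) _; rewrite gt_min; apply/orP; right.
by rewrite ltr_pdivrMr // ltr_pMr // ltr1n.
Qed.

Lemma analytic_at_continuous (f : 'rV[R]_n -> R^o) p :
  analytic_at f p -> {for p, continuous f}.
Proof.
move=> [c [e [B [e0 cB cf]]]].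
have B0 : 0 <= B.
  by apply: le_trans (cB 0); apply: power_sum_ge0 => //; exact: ltW.
(* The constant terms cancel, and passing from radius [e] to [t] shrinks a monomial of positive
   degree at least by the factor [t / e]. *)
have step (t : R) h : 0 < t <= e -> (forall i, `|h 0 i| <= t) ->
    `|f (p + h) - f p| <= t / e * B.
  move=> /andP[t0 te] ht.
  have ch := cf h (fun i => le_trans (ht i) te).
  have c0 : power_sum c 0 @ \oo --> f p.
    by rewrite -[p]addr0; apply: cf => i; rewrite mxE normr0 ltW.
  have cN : (fun N => `|power_sum c h N - power_sum c 0 N|) @ \oo -->
      `|f (p + h) - f p| by apply: cvg_norm; apply: cvgB.
  apply: (cvgr_to_le cN); apply: nearW => N /=.
  apply: (@le_trans _ _ (t / e * power_sum (fun a => `|c a|) (const_mx e) N));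
    last by apply: ler_wpM2l (cB N); rewrite divr_ge0 // ltW.
  rewrite !power_sumE -sumrB; apply: le_trans (ler_norm_sum _ _ _) _.
  rewrite mulr_sumr; apply: ler_sum => a _; rewrite -mulrBr normrM mulrCA.
  apply: ler_wpM2l => //.
  have [a0|/eqP a0] := eqVneq (\sum_i a i)%N 0%N.
    have E x : monomial x a = 1.
      apply: big1 => i _.
      by move/eqP: a0; rewrite sum_nat_eq0 => /forallP/(_ i)/eqP ->.
    by rewrite !E subrr normr0 mulr1 divr_ge0 // ltW.
  have -> : monomial 0 a = 0.
    have -> : 0 = const_mx 0 :> 'rV[R]_n by apply/matrixP => i j; rewrite !mxE.
    by rewrite monomial_const expr0n; case: (\sum_i a i)%N a0.
  rewrite subr0; apply: le_trans (norm_monomial_le _ ht) _.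
  rewrite !monomial_const; case: (\sum_i a i)%N a0 => // k _.
  have -> : t / e * e ^+ k.+1 = t * e ^+ k by rewrite exprS mulrA divfK // gt_eqF.
  rewrite exprS; apply: ler_wpM2l; first exact: ltW.
  by apply: lerXn2r => //; rewrite nnegrE ltW.
apply/(@cvgrPdist_le _ _ _ (nbhs p)) => eps eps0.
(* The second bound gives [t / e * B <= eps]; the divisor [B + 1] is positive even when [B = 0]. *)
pose t := Num.min e (eps * e / (B + 1)).
have B1 : 0 < B + 1 by rewrite ltr_wpDl.
have t0 : 0 < t by rewrite lt_min e0 /= divr_gt0 // mulr_gt0.
have te : 0 < t <= e by rewrite t0 ge_min lexx.
apply/nbhs_ballP; exists t => //= q pq.
rewrite distrC -[q](subrKC p); apply: le_trans (step t (q - p) te _) _.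
  move=> i; have := pq.2 0 i; rewrite /ball /= !mxE distrC => /ltW.
  by [].
rewrite mulrAC ler_pdivrMr //.
have : t <= eps * e / (B + 1) by rewrite ge_min lexx orbT.
rewrite ler_pdivlMr // => h; apply: le_trans h.
by apply: ler_wpM2l; [exact: ltW | rewrite lerDl].
Qed.

Lemma analytic_at_cst (k : R) (p : 'rV[R]_n) : analytic_at (fun=> k : R^o) p.
Proof.
pose c a : R := if a == 0 :> idx then k else 0.
(* Stated for [N.+1]: when [n > 0] the cube of side 0 is empty, and the constant term enters at side
   1. *)
have E (l : R) h N : power_sum (fun a : idx => if a == 0 then l else 0) h N.+1 = l.
  rewrite power_sumE (bigD1_seq 0) ?uniq_cube //=; last first.
    by rewrite mem_cube; apply/forallP => i; rewrite ffunE.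
  rewrite eqxx [monomial _ _]big1 => [|i _]; last by rewrite ffunE expr0.
  by rewrite mulr1 big1 ?addr0 // => a /negPf ->; rewrite mul0r.
have c0 : (fun a => `|c a|) = (fun a => if a == 0 then `|k| else 0).
  by apply/funext => a; rewrite /c; case: eqP; rewrite ?normr0.
exists c, 1, `|k|; split=> // [N|h _].
  rewrite -(E `|k| (const_mx 1) N) c0; apply: power_sum_homo => // a.
  by case: eqP.
by rewrite -(cvg_shiftS (power_sum c h)) /= (funext (E k h)); exact: cvg_cst.
Qed.

Lemma analytic_atD (f g : 'rV[R]_n -> R^o) p :
  analytic_at f p -> analytic_at g p -> analytic_at (f + g) p.
Proof.
move=> [c [e1 [A [e10 cA cf]]]] [d [e2 [B [e20 dB dg]]]].
pose e := Num.min e1 e2.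
have e0 : 0 < e by rewrite lt_min e10.
have e01 : 0 < e <= e1 by rewrite e0 ge_min lexx.
have e02 : 0 < e <= e2 by rewrite e0 ge_min lexx orbT.
have [{}cA {}cf] := analytic_at_shrink e01 cA cf.
have [{}dB {}dg] := analytic_at_shrink e02 dB dg.
have psD a b h N : power_sum (fun m => a m + b m) h N =
    power_sum a h N + power_sum b h N.
  by rewrite !power_sumE -big_split; apply: eq_bigr => m _; rewrite mulrDl.
exists (fun a => c a + d a), e, (A + B); split=> // [N|h he].
  apply: le_trans (lerD (cA N) (dB N)); rewrite -psD !power_sumE.
  apply: ler_sum => a _; apply: ler_wpM2r; last exact: ler_normD.
  by rewrite monomial_const_ge0 // ltW.
rewrite (funext (psD c d h)); apply: cvgD; [exact: cf | exact: dg].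
Qed.

Lemma analytic_atM (f g : 'rV[R]_n -> R^o) p :
  analytic_at f p -> analytic_at g p -> analytic_at (f * g) p.
Proof.
move=> [c [e1 [A [e10 cA cf]]]] [d [e2 [B [e20 dB dg]]]].
pose e := Num.min e1 e2.
have e0 : 0 < e by rewrite lt_min e10.
have e01 : 0 < e <= e1 by rewrite e0 ge_min lexx.
have e02 : 0 < e <= e2 by rewrite e0 ge_min lexx orbT.
have [{}cA {}cf] := analytic_at_shrink e01 cA cf.
have [{}dB {}dg] := analytic_at_shrink e02 dB dg.
exists (cauchy_prod c d), e, (A * B); split=> // [N|h he]; last first.
  exact: power_sum_cauchy_cvg he (ltW e0) cA dB (cf h he) (dg h he).
apply: (@le_trans _ _ (power_sum
    (cauchy_prod (fun a => `|c a|) (fun a => `|d a|)) (const_mx e) N)).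
  rewrite !power_sumE; apply: ler_sum => a _; apply: ler_wpM2r.
    by rewrite monomial_const_ge0 // ltW.
  exact: norm_cauchy_prod_le.
apply: le_trans (power_sum_cauchy_le _ _ (ltW e0) N) _ => //.
by apply: ler_pM => //; apply: power_sum_ge0 => //; exact: ltW.
Qed.

End MultiIndex.

(** * The structure sheaf *)

Section ClassOn.
Variables (R : realType) (g : geometry) (n : nat).
Local Notation K := (scalars R g).
Implicit Types (D : set 'rV[K]_n) (f h : 'rV[K]_n -> K).

(** The case analysis on the three categories is confined to this section; later facts about [O]
    rest on the closure properties and the continuity shown here. *)
Lemma class_on_eq D f h : open D -> {in D, f =1 h} -> class_on D f -> class_on D h.
Proof.
case: g D f h => D f h oD fh /= cf.
- by move=> k; apply: Ck_eq (cf k).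
- move=> p Dp; apply: analytic_at_eq (cf p Dp).
  by apply: filterS (open_nbhs_nbhs (conj oD Dp)) => q /mem_set /fh.
- move=> p Dp; apply: near_eq_differentiable (cf p Dp).
  by apply: filterS (open_nbhs_nbhs (conj oD Dp)) => q /mem_set /fh.
Qed.

Lemma class_on_subset D D' f : D' `<=` D -> class_on D f -> class_on D' f.
Proof.
case: g D D' f => D D' f sD /= cf.
- by move=> k; apply: Ck_subset (cf k).
- by move=> p /sD; apply: cf.
- by move=> p /sD; apply: cf.
Qed.

Lemma class_on_cst D (a : K) : class_on D (fun=> a).
Proof.
case: g D a => D a /=.
- by move=> k; apply: Ck_cst.
- by move=> p _; apply: analytic_at_cst.
- by move=> p _; exact: (differentiable_cst (a : R[i]^o) p).
Qed.

Lemma class_onD D f h : open D -> class_on D f -> class_on D h ->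
  class_on D (fun p => f p + h p).
Proof.
case: g D f h => D f h oD /= cf ch.
- by move=> k; exact: CkD oD (cf k) (ch k).
- by move=> p Dp; exact: analytic_atD (cf p Dp) (ch p Dp).
- by move=> p Dp; exact: differentiableD (cf p Dp) (ch p Dp).
Qed.

Lemma class_onM D f h : open D -> class_on D f -> class_on D h ->
  class_on D (fun p => f p * h p).
Proof.
case: g D f h => D f h oD /= cf ch.
- by move=> k; exact: CkM oD (cf k) (ch k).
- by move=> p Dp; exact: analytic_atM (cf p Dp) (ch p Dp).
- by move=> p Dp; exact: differentiableM (cf p Dp) (ch p Dp).
Qed.

Lemma class_on_continuous D f p : class_on D f -> D p ->
  {for p, continuous (f : _ -> K^o)}.
Proof.
case: g D f p => D f p /= cf Dp.
- exact: (cf 0%N).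
- exact: analytic_at_continuous (cf p Dp).
- exact: differentiable_continuous (cf p Dp).
Qed.

End ClassOn.

Section StructureSheaf.
Variables (R : realType) (g : geometry) (n : nat) (M : manifold R g n).
Local Notation K := (scalars R g).
Implicit Types (U V W : set M) (f h : M -> K).

Lemma chart_image_open (c : chart K n M) V : open V ->
  open (cmap c @` (V `&` cdom c)).
Proof.
move=> oV; rewrite openE => _ [x [Vx cx] <-].
have Dx : (cmap c @` cdom c) (cmap c x) by exists x.
have ci := @cinv_cont _ _ _ c (cmap c x) Dx.
have nV : nbhs (cinv c (cmap c x)) V.
  by rewrite cmapK //; apply: open_nbhs_nbhs.
have nV' : \forall q \near cmap c x, V (cinv c q) := ci _ nV.
have nD : \forall q \near cmap c x, (cmap c @` cdom c) q.
  exact: open_nbhs_nbhs (conj (@cimg_open _ _ _ c) Dx).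
apply: filterS2 nV' nD => q /= Vq [y cy yq]; exists y => //; split=> //.
by rewrite -(cmapK cy) yq.
Qed.

Lemma structure_sheaf_eq V f h : open V -> {in V, f =1 h} ->
  structure_sheaf V f -> structure_sheaf V h.
Proof.
move=> oV fh Of c ac; apply: class_on_eq (Of c ac); first exact: chart_image_open.
by move=> _ /set_mem[x [Vx cx] <-] /=; rewrite cmapK // fh // mem_set.
Qed.

Lemma structure_sheaf_subset V W f : W `<=` V ->
  structure_sheaf V f -> structure_sheaf W f.
Proof.
move=> WV Of c ac; apply: class_on_subset (Of c ac).
by apply: image_subset; apply: setSI.
Qed.

Lemma structure_sheaf_cst V (a : K) : structure_sheaf V (fun=> a).
Proof. by move=> c ac; apply: class_on_cst. Qed.

Lemma structure_sheafD V f h : open V -> structure_sheaf V f ->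
  structure_sheaf V h -> structure_sheaf V (fun x => f x + h x).
Proof.
move=> oV Of Oh c ac.
by have := class_onD (@chart_image_open c V oV) (Of c ac) (Oh c ac).
Qed.

Lemma structure_sheafM V f h : open V -> structure_sheaf V f ->
  structure_sheaf V h -> structure_sheaf V (fun x => f x * h x).
Proof.
move=> oV Of Oh c ac.
by have := class_onM (@chart_image_open c V oV) (Of c ac) (Oh c ac).
Qed.

Lemma structure_sheaf_sum V (I : Type) (r : seq I) (P : pred I) (F : I -> M -> K) :
  open V -> (forall i, P i -> structure_sheaf V (F i)) ->
  structure_sheaf V (fun x => \sum_(i <- r | P i) F i x).
Proof.
move=> oV OF; elim: r => [|i r IH].
  apply: structure_sheaf_eq (structure_sheaf_cst V 0) => // x _.
  by rewrite big_nil.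
case Pi: (P i); last first.
  by apply: structure_sheaf_eq IH => // x _; rewrite big_cons Pi.
apply: structure_sheaf_eq (structure_sheafD oV (OF i Pi) IH) => // x _.
by rewrite big_cons Pi.
Qed.

Lemma structure_sheaf_prod V (I : Type) (r : seq I) (P : pred I) (F : I -> M -> K) :
  open V -> (forall i, P i -> structure_sheaf V (F i)) ->
  structure_sheaf V (fun x => \prod_(i <- r | P i) F i x).
Proof.
move=> oV OF; elim: r => [|i r IH].
  apply: structure_sheaf_eq (structure_sheaf_cst V 1) => // x _.
  by rewrite big_nil.
case Pi: (P i); last first.
  by apply: structure_sheaf_eq IH => // x _; rewrite big_cons Pi.
apply: structure_sheaf_eq (structure_sheafM oV (OF i Pi) IH) => // x _.
by rewrite big_cons Pi.
Qed.

(** Continuity in the preferred chart makes nonvanishing an open condition. Applied to determinants,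
    it keeps minors invertible near a point. *)
Lemma structure_sheaf_neq0 V f x : open V -> structure_sheaf V f -> V x ->
  f x != 0 -> \forall y \near x, f y != 0.
Proof.
move=> oV Of Vx fx.
pose c := chart_at M x; have cx : cdom c x := chart_at_dom x.
have D : (cmap c @` (V `&` cdom c)) (cmap c x) by exists x.
have cf := class_on_continuous (Of c (chart_at_atlas x)) D.
have cfx : (f \o cinv c) (cmap c x) != 0 by rewrite /= cmapK.
have nf : \forall q \near cmap c x, (f \o cinv c) q != 0.
  exact: cvgr_neq0 cf cfx.
have := cmap_cont cx nf.
apply: filterS2 (open_nbhs_nbhs (conj (@cdom_open _ _ _ c) cx)) => y cy /=.
by rewrite cmapK.
Qed.

(** * Matrices with entries in the structure sheaf *)

Definition mx_sheaf V m k (A : M -> 'M[K]_(m, k)) : Prop :=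
  forall i j, structure_sheaf V (fun x => A x i j).

Lemma mx_sheaf_cst V m k (A : 'M[K]_(m, k)) : mx_sheaf V (fun=> A).
Proof. by move=> i j; exact: structure_sheaf_cst. Qed.

Lemma mx_sheaf_subset V W m k (A : M -> 'M[K]_(m, k)) : W `<=` V ->
  mx_sheaf V A -> mx_sheaf W A.
Proof. by move=> WV OA i j; apply: structure_sheaf_subset (OA i j). Qed.

Lemma mx_sheafM V m k l (A : M -> 'M[K]_(m, k)) (B : M -> 'M[K]_(k, l)) :
  open V -> mx_sheaf V A -> mx_sheaf V B -> mx_sheaf V (fun x => A x *m B x).
Proof.
move=> oV OA OB i j.
apply: (@structure_sheaf_eq _ (fun x => \sum_t A x i t * B x t j)) => //.
  by move=> x _; rewrite mxE.
by apply: structure_sheaf_sum => // t _; apply: structure_sheafM.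
Qed.

Lemma mx_sheafB V m k (A B : M -> 'M[K]_(m, k)) :
  open V -> mx_sheaf V A -> mx_sheaf V B -> mx_sheaf V (fun x => A x - B x).
Proof.
move=> oV OA OB i j.
apply: (@structure_sheaf_eq _ (fun x => A x i j + (-1) * B x i j)) => //.
  by move=> x _; rewrite !mxE mulN1r.
apply: structure_sheafD => //; apply: structure_sheafM => //.
exact: structure_sheaf_cst.
Qed.

Lemma mx_sheafZ V m k (f : M -> K) (A : M -> 'M[K]_(m, k)) : open V ->
  structure_sheaf V f -> mx_sheaf V A -> mx_sheaf V (fun x => f x *: A x).
Proof.
move=> oV Of OA i j.
apply: structure_sheaf_eq (structure_sheafM oV Of (OA i j)) => // x _.
by rewrite mxE.
Qed.

Lemma structure_sheaf_det V m (A : M -> 'M[K]_m) : open V -> mx_sheaf V A ->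
  structure_sheaf V (fun x => \det (A x)).
Proof.
move=> oV OA; apply: structure_sheaf_sum => // s _.
apply: structure_sheafM => //; first exact: structure_sheaf_cst.
by apply: structure_sheaf_prod => // i _; exact: OA.
Qed.

Lemma mx_sheaf_adj V m (A : M -> 'M[K]_m) : open V -> mx_sheaf V A ->
  mx_sheaf V (fun x => \adj (A x)).
Proof.
move=> oV OA i j.
apply: (@structure_sheaf_eq _ (fun x =>
    (-1) ^+ (j + i) * \det (row' j (col' i (A x))))) => //.
  by move=> x _; rewrite mxE.
apply: structure_sheafM => //; first exact: structure_sheaf_cst.
apply: structure_sheaf_det => // i' j'.
by apply: structure_sheaf_eq (OA (lift j i') (lift i j')) => // x _; rewrite !mxE.
Qed.

End StructureSheaf.

(** * Matrices and bundles *)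

Section Rank.
Variable K : fieldType.

(** [P] and [Q] act as the choice of a nonzero minor of maximal size, read off from the Gaussian
    normal form. With both fixed, [\det (P *m B *m Q) != 0] is an open condition on [B] that forces
    its rank to be at least [\rank A]. *)
Lemma rank_factor m k (A : 'M[K]_(m, k)) :
  exists (P : 'M[K]_(\rank A, m)) (Q : 'M[K]_(k, \rank A)), P *m A *m Q = 1%:M.
Proof.
exists (pid_mx (\rank A) *m invmx (col_ebase A)).
exists (invmx (row_ebase A) *m pid_mx (\rank A)).
transitivity (pid_mx (\rank A) *m invmx (col_ebase A) *m
  (col_ebase A *m pid_mx (\rank A) *m row_ebase A) *m
  (invmx (row_ebase A) *m pid_mx (\rank A)) : 'M[K]_(\rank A)).
  by congr (_ *m _ *m _); rewrite mulmx_ebase.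
rewrite !mulmxA mulmxKV ?col_ebase_unit //.
rewrite mulmxK ?row_ebase_unit // !mul_pid_mx !minnn.
rewrite (minn_idPr (rank_leq_row A)) minnn (minn_idPr (rank_leq_col A)).
by rewrite pid_mx_1.
Qed.

(** The kernel of [A] is contained in that of [A *m B], and the rank hypothesis makes their
    dimensions equal. *)
Lemma mulmx_rank_cancel m k l (A : 'M[K]_(m, k)) (B : 'M[K]_(k, l)) (u : 'rV[K]_m) :
  (\rank A <= \rank (A *m B))%N -> u *m (A *m B) = 0 -> u *m A = 0.
Proof.
move=> rAB uAB; apply/sub_kermxP.
have kAB : (kermx A <= kermx (A *m B))%MS.
  by apply/sub_kermxP; rewrite mulmxA mulmx_ker mul0mx.
have : (kermx A == kermx (A *m B))%MS.
  rewrite -(geq_leqif (mxrank_leqif_eq kAB)) !mxrank_ker.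
  exact: leq_sub2l.
by move/eqmxP => ->; apply/sub_kermxP.
Qed.

(* The adjugate replaces the inverse of [P *m A *m Q], so that the entries of
   this vector are polynomials in those of [A]. *)
Lemma mulmx_ker_adj m k r (A : 'M[K]_(m, k)) (P : 'M[K]_(r, m)) (Q : 'M[K]_(k, r))
    (v : 'rV[K]_m) : (\rank A <= r)%N -> \det (P *m A *m Q) != 0 ->
  (\det (P *m A *m Q) *: v - v *m A *m Q *m \adj (P *m A *m Q) *m P) *m A = 0.
Proof.
(* [P *m A *m Q] is invertible of size [r], so [A *m Q] has rank at least [\rank A] and [Q] can be
   cancelled. *)
move=> rA dA; apply: (@mulmx_rank_cancel _ _ _ _ Q).
  apply: leq_trans rA _; apply: leq_trans (mxrankM_maxr P _).
  rewrite mulmxA mxrank_unit //; by rewrite unitmxE unitfE.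
have -> (B : 'M[K]_r) : (\det (P *m A *m Q) *: v - v *m A *m Q *m B *m P) *m (A *m Q) =
    \det (P *m A *m Q) *: (v *m (A *m Q)) - v *m A *m Q *m (B *m (P *m A *m Q)).
  by rewrite mulmxBl scalemxAl !mulmxA.
by rewrite mul_adj_mx mul_mx_scalar mulmxA subrr.
Qed.

Lemma leq_rank_det m k r (A : 'M[K]_(m, k)) (P : 'M[K]_(r, m)) (Q : 'M[K]_(k, r)) :
  \det (P *m A *m Q) != 0 -> (r <= \rank A)%N.
Proof.
move=> dA; have <- : \rank (P *m A *m Q) = r.
  by rewrite mxrank_unit // unitmxE unitfE.
exact: leq_trans (mxrankM_maxl _ _) (mxrankM_maxr _ _).
Qed.

Lemma linear_mxP m k (f : 'rV[K]_m -> 'rV[K]_k) : linear f ->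
  exists A : 'M[K]_(m, k), forall u, f u = u *m A.
Proof.
move=> lf; pose f' : {linear 'rV[K]_m -> 'rV[K]_k} :=
  HB.pack f (GRing.isLinear.Build K _ _ _ f lf).
by exists (lin1_mx f') => u; rewrite mul_rV_lin1.
Qed.

End Rank.

(** * Semicontinuity and maxima *)

Section Open.
Variable T : topologicalType.

Lemma near_open (x : T) (P : T -> Prop) : (\forall y \near x, P y) ->
  exists W : set T, [/\ open W, W x & forall y, W y -> P y].
Proof.
move=> nP; exists (interior [set y | P y]); split=> //.
- exact: open_interior.
- exact: interior_subset.
Qed.

(** At a point where the bounded function attains its maximum over [V], semicontinuity gives one
    inequality nearby and maximality the other. *)
Lemma lower_semicontinuous_max (V : set T) (f : T -> nat) (b : nat) :
  open V -> V !=set0 -> (forall x, V x -> (f x <= b)%N) ->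
  (forall x, V x -> \forall y \near x, (f x <= f y)%N) ->
  exists x, V x /\ \forall y \near x, f y = f x.
Proof.
move=> oV [x0 Vx0] fb fl.
pose p q := `[< exists2 x, V x & f x = q >].
have ex : exists q, p q by exists (f x0); apply/asboolP; exists x0.
have ub q : p q -> (q <= b)%N by move=> /asboolP[x Vx <-]; exact: fb.
case: (ex_maxnP ex ub) => q /asboolP[x Vx fx] qmax.
exists x; split=> //.
apply: filterS2 (fl x Vx) (open_nbhs_nbhs (conj oV Vx)) => y fxy Vy.
apply/eqP; rewrite eqn_leq fxy andbT fx; apply: qmax.
by apply/asboolP; exists y.
Qed.

End Open.

Section Bundles.
Variables (R : realType) (g : geometry) (n : nat) (M : manifold R g n).
Local Notation K := (scalars R g).
Implicit Types (U V W : set M).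

Lemma leq_rank_near V m k (A : M -> 'M[K]_(m, k)) x : open V -> V x ->
  mx_sheaf V A -> \forall y \near x, (\rank (A x) <= \rank (A y))%N.
Proof.
move=> oV Vx OA; have [P [Q PQ]] := rank_factor (A x).
have OPQ : structure_sheaf V (fun y => \det (P *m A y *m Q)).
  apply: structure_sheaf_det => //.
  apply: mx_sheafM => //; last exact: mx_sheaf_cst.
  by apply: mx_sheafM => //; exact: mx_sheaf_cst.
have := structure_sheaf_neq0 oV OPQ Vx; rewrite PQ det1 oner_eq0 => /(_ isT).
by apply: filterS => y; exact: leq_rank_det.
Qed.

Lemma constant_rank V m k (A : M -> 'M[K]_(m, k)) : open V -> V !=set0 ->
  mx_sheaf V A -> exists W, [/\ open W, W !=set0, W `<=` V &
    exists r, forall x, W x -> \rank (A x) = r].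
Proof.
move=> oV V0 OA.
have [||x [Vx nx]] := lower_semicontinuous_max
    (f := fun x => \rank (A x)) (b := m) oV V0.
- by move=> x _; exact: rank_leq_row.
- by move=> x Vx; exact: leq_rank_near OA.
have [W [oW Wx WP]] := near_open (filterI nx (open_nbhs_nbhs (conj oV Vx))).
exists W; split=> //; first by exists x.
- by move=> y /WP[].
- by exists (\rank (A x)) => y /WP[].
Qed.

(** The constant vector [v] is scaled by [\det (P *m A y *m Q)] and corrected into the kernel by
    [mulmx_ker_adj], which applies because the rank is constant. At [x] the determinant is 1 and the
    correction vanishes, as [v] is already in the kernel. *)
Lemma kernel_extension V m k (A : M -> 'M[K]_(m, k)) x (v : 'rV[K]_m) :
  open V -> V x -> mx_sheaf V A -> (forall y, V y -> \rank (A y) = \rank (A x)) ->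
  v *m A x = 0 ->
  exists W (w : M -> 'rV[K]_m), [/\ open W, W x, W `<=` V, mx_sheaf W w &
    w x = v /\ forall y, W y -> w y *m A y = 0].
Proof.
move=> oV Vx OA rA vA; have [P [Q PQ]] := rank_factor (A x).
have OS : mx_sheaf V (fun y => P *m A y *m Q).
  apply: mx_sheafM => //; last exact: mx_sheaf_cst.
  by apply: mx_sheafM => //; exact: mx_sheaf_cst.
have Od := structure_sheaf_det oV OS.
have := structure_sheaf_neq0 oV Od Vx; rewrite PQ det1 oner_eq0 => /(_ isT) nd.
have [W [oW Wx WP]] := near_open (filterI nd (open_nbhs_nbhs (conj oV Vx))).
have WV : W `<=` V by move=> y /WP[].
exists W, (fun y => \det (P *m A y *m Q) *: v -
  v *m A y *m Q *m \adj (P *m A y *m Q) *m P); split=> //.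
- apply: mx_sheaf_subset WV _; apply: mx_sheafB => //.
    by apply: mx_sheafZ => //; exact: mx_sheaf_cst.
  apply: mx_sheafM => //; last exact: mx_sheaf_cst.
  apply: mx_sheafM => //; last exact: mx_sheaf_adj.
  apply: mx_sheafM => //; last exact: mx_sheaf_cst.
  by apply: mx_sheafM => //; exact: mx_sheaf_cst.
split=> [|y Wy]; first by rewrite PQ det1 scale1r vA !mul0mx subr0.
by have [dy Vy] := WP y Wy; apply: mulmx_ker_adj; rewrite ?rA.
Qed.

(** * Sections in a local trivialization *)

Section OneBundle.
Variables (U : set M) (E : bundle_data M).
Hypothesis vbE : vector_bundle U E.

Lemma triv_linear a x : U x -> tdom a x -> linear (@triv _ _ _ _ E a x).
Proof. by case: vbE => _ _ bij _ Ux ax; have [] := bij a x (conj Ux ax). Qed.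

Lemma triv_inj a x : U x -> tdom a x -> injective (@triv _ _ _ _ E a x).
Proof. by case: vbE => _ _ bij _ Ux ax; have [_ /bij_inj] := bij a x (conj Ux ax). Qed.

Lemma triv_surj a x (u : 'rV[K]_(rk E)) : U x -> tdom a x ->
  exists e : fib E x, triv a e = u.
Proof.
case: vbE => _ _ bij _ Ux ax; have [_ [f _ fK]] := bij a x (conj Ux ax).
by exists (f u); rewrite fK.
Qed.

(** Transition matrices have entries in [O], so a single trivialization over [W] suffices to
    recognize a section. *)
Lemma is_section_triv W a (s : forall x, fib E x) : open W ->
  W `<=` U -> W `<=` tdom a -> mx_sheaf W (fun x => triv a (s x)) ->
  is_section W s.
Proof.
move=> oW WU Wa Os b j; case: vbE => otd _ _ tr.
have oWb : open (W `&` tdom b) by apply: openI => //; exact: otd.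
have [h [Oh hE]] := tr a b.
have sub : W `&` tdom b `<=` U `&` tdom a `&` tdom b.
  by move=> x [Wx bx]; split=> //; split; [exact: WU | exact: Wa].
have Osh := mx_sheafM oWb (mx_sheaf_subset (@subIsetl _ _ _) Os)
  (fun i j => structure_sheaf_subset sub (Oh i j)).
apply: structure_sheaf_eq (Osh 0 j) => // x /set_mem /sub Wx.
by rewrite hE.
Qed.

Lemma section_of_triv W a (w : M -> 'rV[K]_(rk E)) : open W ->
  W `<=` U -> W `<=` tdom a -> mx_sheaf W w ->
  exists s : forall x, fib E x, is_section W s /\
    forall x, W x -> triv a (s x) = w x.
Proof.
move=> oW WU Wa Ow.
suff [s sE] : exists s : forall x, fib E x, forall x, W x -> triv a (s x) = w x.
  exists s; split=> //; apply: (is_section_triv (a := a)) => // i j.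
  by apply: structure_sheaf_eq (Ow i j) => // x /set_mem Wx; rewrite sE.
(* A section is a total function; outside [W] the condition is void and 0 witnesses it. *)
have ex x : exists e : fib E x, W x -> triv a e = w x.
  case: (pselect (W x)) => Wx; last by exists 0.
  by have [e ?] := triv_surj (w x) (WU x Wx) (Wa x Wx); exists e.
by exists (fun x => projT1 (cid (ex x))) => x; exact: (projT2 (cid (ex x))).
Qed.

End OneBundle.

End Bundles.

(** * Exactness at generic points *)

(** Telescoping of rank and nullity in an exact complex: [r i] is the dimension of the term of index
    [i], [q i] the rank of the map leaving it, [q i.+1] the rank of the map arriving at it. *)
Lemma alternating_rank (N : nat) (r q : nat -> nat) :
  (forall k, (k < N)%N -> (q k + q k.+1 = r k)%N) -> q N = 0%N ->
  (q 0%N)%:Z = \sum_(i < N) (-1) ^+ i * (r i)%:Z.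
Proof.
move=> qr qN; suff H k : (k <= N)%N ->
    (q 0%N)%:Z = \sum_(i < k) (-1) ^+ i * (r i)%:Z + (-1) ^+ k * (q k)%:Z.
  by rewrite (H N (leqnn N)) qN mulr0 addr0.
elim: k => [|k IH] kN; first by rewrite big_ord0 add0r mul1r.
rewrite (IH (ltnW kN)) big_ord_recr /= -(qr k kN) PoszD exprS mulN1r.
by rewrite -addrA mulrDr mulNr addrK.
Qed.

Section Generic.
Variables (R : realType) (g : geometry) (n : nat) (M : manifold R g n).
Local Notation K := (scalars R g).
Implicit Types (U V W : set M).

(** Passes from exactness on sections to exactness on fibres. Constant rank of [A] extends a kernel
    vector to a section of the kernel, whose local lift shows that the vector lies in the image of
    [h]. [A] is left abstract to cover both [rho] in a chart and the maps [res_d]. *)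
Lemma exact_rank U (E1 E2 : bundle_data M)
    (phi : forall x, {linear fib E2 x -> fib E1 x}) W
    (a1 : tindex E1) (a2 : tindex E2) (h : M -> 'M[K]_(rk E2, rk E1))
    k (A : M -> 'M[K]_(rk E1, k)) (r : nat) :
  vector_bundle U E1 -> vector_bundle U E2 ->
  open W -> W `<=` U -> W `<=` tdom a1 -> W `<=` tdom a2 ->
  mx_sheaf W h ->
  (forall x, W x -> forall e, triv a1 (phi x e) = triv a2 e *m h x) ->
  mx_sheaf W A -> (forall x, W x -> \rank (A x) = r) ->
  (forall V (s : forall x, fib E1 x), open V -> V `<=` W -> is_section V s ->
    (forall x, V x -> triv a1 (s x) *m A x = 0) <->
    (forall x, V x -> exists W t, [/\ open W, W x, W `<=` V, is_section W t &
       forall y, W y -> phi y (t y) = s y])) ->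
  forall y, W y -> (\rank (A y) + \rank (h y) = rk E1)%N.
Proof.
move=> vb1 vb2 oW WU Wa1 Wa2 Oh hE OA rA ex y Wy.
(* Each row of [h y] is the image of a basis vector; extended to a constant section, that vector has
   an image under [phi] which exactness puts in the kernel. *)
have hA : h y *m A y = 0.
  apply/row_matrixP => i; rewrite row_mul row0 rowE.
  have [t [st tE]] := section_of_triv vb2 oW WU Wa2
    (mx_sheaf_cst W (delta_mx 0 i : 'rV[K]_(rk E2))).
  have ss : is_section W (fun x => phi x (t x)).
    apply: (is_section_triv vb1 oW WU Wa1) => i' j'.
    apply: structure_sheaf_eq (mx_sheafM oW (mx_sheaf_cst W (delta_mx 0 i)) Oh i' j').
      by [].
    by move=> x /set_mem Wx; rewrite hE // tE.
  have [_ tex] := ex W (fun x => phi x (t x)) oW (@subset_refl _ _) ss.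
  rewrite -(tE y Wy) -hE //; apply: tex => // x Wx.
  by exists W, t; split.
have kA : (kermx (A y) <= h y)%MS.
  apply/rV_subP => v /sub_kermxP vA.
  have [|W' [w [oW' W'y W'W Ow [wy wA]]]] := kernel_extension oW Wy OA _ vA.
    by move=> x Wx; rewrite !rA.
  have W'U := subset_trans W'W WU.
  have W'a1 := subset_trans W'W Wa1.
  have [s [ss sE]] := section_of_triv vb1 oW' W'U W'a1 Ow.
  have [sex _] := ex W' s oW' W'W ss.
  have [|W'' [t [oW'' W''y W''W' st tE]]] := sex _ y W'y.
    by move=> x W'x; rewrite sE // wA.
  by rewrite -wy -sE // -tE // hE // submxMl.
have kh : (kermx (A y) :=: h y)%MS.
  by apply/eqmxP/andP; split=> //; apply/sub_kermxP.
by rewrite -kh mxrank_ker subnKC // rank_leq_row.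
Qed.

(** The map being differentiated agrees with the identity near [cmap c x]. *)
Lemma tangent_coord_chart_at (x : M) : tangent_coord (chart_at M x) x =1 id.
Proof.
move=> v; rewrite /tangent_coord; set c := chart_at M x.
have cx : (cmap c @` cdom c) (cmap c x) by exists x => //; exact: chart_at_dom.
have idE : {near cmap c x, id =1 (cmap c \o cinv c)}.
  apply: filterS (open_nbhs_nbhs (conj (@cimg_open _ _ _ c) cx)).
  by move=> _ [y cy <-] /=; rewrite cmapK.
have idd : is_diff (cmap c x) id (idfun : {linear 'rV[K]_n -> 'rV[K]_n}).
  exact: is_diff_id.
by have [_ ->] := near_eq_is_diff idE idd.
Qed.

Variable F : set M -> set (M -> 'rV[K]_n).

Lemma has_dim_unique (S : set 'rV[K]_n) r r' : has_dim S r -> has_dim S r' -> r = r'.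
Proof.
move=> [A [fA ->]] [B [fB AB]].
have eAB : (A :=: B)%MS.
  by apply/eqmxP/andP; split; apply/rV_subP => v;
     [move=> vA; have : [set v | (v <= A)%MS] v by []; rewrite AB
     |move=> vB; have : [set v | (v <= B)%MS] v by []; rewrite -AB].
by rewrite -(eqP fA) -(eqP fB) eAB.
Qed.

(** * A resolution over an open set that trivializes its bundles up to index [L] *)

Section Local.
Variables (U : set M) (E : geometric_resolution F U) (L : nat) (V : set M).
Hypothesis singF : singular_foliation F.
Hypotheses (oV : open V) (VU : V `<=` U).
Variable a : forall i, tindex (res_E E i).
Hypothesis Va : forall i, (i <= L)%N -> V `<=` tdom (a i).

(** A pointwise matrix only: each tangent space is identified with [K^n] by its own preferred chart,
    which may jump from point to point, so no regularity of [B] is claimed. *)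
Lemma rho_mx : exists B : M -> 'M[K]_(rk (res_E E 0), n),
  forall x, V x -> forall e, res_rho E x e = triv (a 0) e *m B x.
Proof.
have vb := res_bundle E 0.
have ex x : exists B : 'M[K]_(rk (res_E E 0), n),
    V x -> forall e, res_rho E x e = triv (a 0) e *m B.
  case: (pselect (V x)) => Vx; last by exists 0.
  have Ux := VU Vx; have ax := Va (leq0n L) Vx.
  have tl := triv_linear vb Ux ax; have ti := triv_inj vb Ux ax.
  have [f fE] := choice (fun u => triv_surj vb u Ux ax).
  have lf : linear (fun u => res_rho E x (f u)).
    move=> k u v /=.
    have -> : f (k *: u + v) = k *: f u + f v.
      by apply: ti; rewrite tl !fE.
    exact: linearP.
  have [B BE] := linear_mxP lf.
  by exists B => _ e; rewrite -BE; congr (res_rho E x _); apply: ti; rewrite fE.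
by have [B BE] := choice ex; exists B => x Vx e; exact: BE.
Qed.

(** One inclusion lifts a vector field locally through [rho]; the other extends a fibre vector to a
    constant section. *)
Lemma fol_at_rho (B : M -> 'M[K]_(rk (res_E E 0), n)) x :
  (forall x, V x -> forall e, res_rho E x e = triv (a 0) e *m B x) -> V x ->
  fol_at F x = [set v | (v <= B x)%MS].
Proof.
move=> BE Vx; apply/seteqP; split=> v /=.
  move=> [V' [X [oV' V'x FX <-]]].
  have oVV : open (V' `&` V) by exact: openI.
  have [|W [s [oW Wx _ _ sE]]] := @res_rho_surj _ _ _ _ _ _ E _ _ oVV _
    (fol_restrict singF oV' oVV (@subIsetl _ _ _) FX) x (conj V'x Vx).
    by move=> y [_ /VU].
  by rewrite -sE // BE // submxMl.
move/submxP => [u ->].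
have [s [ss sE]] := section_of_triv (res_bundle E 0) oV VU (Va (leq0n L))
  (mx_sheaf_cst V u).
exists V, (fun x => res_rho E x (s x)); split=> //; first exact: res_rho_in.
by rewrite BE // sE.
Qed.

Lemma constant_ranks (h : forall i, M -> 'M[K]_(rk (res_E E i.+1), rk (res_E E i))) l :
  V !=set0 -> (forall i, (i < l)%N -> mx_sheaf V (h i)) ->
  exists W, [/\ open W, W !=set0, W `<=` V &
    forall i, (i < l)%N -> exists r, forall x, W x -> \rank (h i x) = r].
Proof.
move=> V0; elim: l => [|l IH] Oh; first by exists V; split.
have [i il|W [oW W0 WV hW]] := IH; first by apply: Oh; rewrite ltnS ltnW.
have [|W' [oW' W'0 W'W [r rW']]] := constant_rank oW W0 (A := h l).
  exact: mx_sheaf_subset WV (Oh l (ltnSn l)).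
exists W'; split=> //; first exact: subset_trans W'W WV.
move=> i; rewrite ltnS leq_eqVlt => /predU1P[-> |/hW[r' rW]]; first by exists r.
by exists r' => x /W'W; exact: rW.
Qed.

Lemma generic_rank_triv : V !=set0 -> length_le E L ->
  exists W r, [/\ open W, W !=set0, W `<=` V,
    r%:Z = \sum_(i < L) (-1) ^+ i * (rk (res_E E i))%:Z
    & forall x, W x -> has_dim (fol_at F x) r].
Proof.
move=> V0 lenE.
have [B BE] := rho_mx.
(* Trivializations are controlled only up to index [L]; for [i >= L] the matrix 0 witnesses
   existence. *)
have hex i : exists h : M -> 'M[K]_(rk (res_E E i.+1), rk (res_E E i)), (i < L)%N ->
    mx_sheaf V h /\ forall x, V x -> forall e,
      triv (a i) (res_d E i x e) = triv (a i.+1) e *m h x.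
  case: (ltnP i L) => iL; last by exists (fun=> 0).
  have [h [Oh hE]] := @res_d_morphism _ _ _ _ _ _ E i (a i.+1) (a i).
  have sub : V `<=` U `&` tdom (a i.+1) `&` tdom (a i).
    move=> x Vx; split; last exact: Va (ltnW iL) _ Vx.
    by split; [exact: VU | exact: Va Vx].
  exists h => _; split; first by move=> j k; exact: structure_sheaf_subset sub (Oh j k).
  by move=> x /sub; exact: hE.
pose h i := projT1 (cid (hex i)).
have Oh i : (i < L)%N -> mx_sheaf V (h i) by move=> /(projT2 (cid (hex i)))[].
have hE i : (i < L)%N -> forall x, V x -> forall e,
    triv (a i) (res_d E i x e) = triv (a i.+1) e *m h i x.
  by move=> /(projT2 (cid (hex i)))[].
have [W1 [oW1 W10 W1V hW1]] := constant_ranks V0 Oh.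
(* In one fixed chart, the preferred one at [x], the matrix of [rho] does have entries in [O]. *)
have cex (x : M) : exists hr : M -> 'M[K]_(rk (res_E E 0), n),
    let c := chart_at M x in
    mx_sheaf (V `&` cdom c) hr /\ forall y, V y -> cdom c y -> forall e,
      tangent_coord c y (res_rho E y e) = triv (a 0) e *m hr y.
  pose c : tindex (tangent M) := exist _ (chart_at M x) (chart_at_atlas x).
  have [hr [Ohr hrE]] := @res_rho_morphism _ _ _ _ _ _ E (a 0) c.
  have sub : V `&` cdom (chart_at M x) `<=` U `&` tdom (a 0) `&` tdom c.
    by move=> y [Vy cy]; split=> //; split; [exact: VU | exact: Va Vy].
  exists hr => /=; split.
    by move=> j k; exact: structure_sheaf_subset sub (Ohr j k).
  by move=> y Vy cy; apply: hrE; apply: sub.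
have [hr hrP] := choice cex.
(* The matrix of the change of tangent coordinates at [y], from the preferred chart at [y] to that
   at [x]; it relates [B] to [hr x]. *)
pose T (x y : M) : 'M[K]_n := lin1_mx
  ('d (cmap (chart_at M x) \o cinv (chart_at M y)) (cmap (chart_at M y) y)).
have TE x y v : tangent_coord (chart_at M x) y v = v *m T x y.
  by rewrite mul_rV_lin1.
have hrT x y : V y -> cdom (chart_at M x) y -> hr x y = B y *m T x y.
  move=> Vy cy; apply/row_matrixP => i; rewrite !rowE mulmxA.
  have [_ E2] := hrP x.
  have [e <-] := triv_surj (res_bundle E 0) (delta_mx 0 i) (VU Vy) (Va (leq0n L) Vy).
  by rewrite -E2 // TE BE.
(* [tangent_coord c y] is not known to be injective. It is the identity for
   [y = x] and [c = chart_at M x], which makes the rank of [B] lower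
   semicontinuous; where that rank is constant, [hr x] has the same rank, hence
   the same kernel, as [B]. *)
have hrB x : V x -> \rank (hr x x) = \rank (B x).
  move=> Vx; rewrite hrT //; last exact: chart_at_dom.
  suff -> : T x x = 1%:M by rewrite mulmx1.
  apply/row_matrixP => i; rewrite !rowE -TE tangent_coord_chart_at.
  by rewrite mulmx1.
have hr_le x y : V y -> cdom (chart_at M x) y -> (\rank (hr x y) <= \rank (B y))%N.
  by move=> Vy cy; rewrite hrT // mxrankM_maxl.
have near_c (x : M) : \forall y \near x, cdom (chart_at M x) y.
  exact: open_nbhs_nbhs (conj (@cdom_open _ _ _ _) (chart_at_dom x)).
have near_hr x : V x -> \forall y \near x, (\rank (B x) <= \rank (hr x y))%N.
  move=> Vx; rewrite -hrB //; have [Ohr _] := hrP x.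
  have oVc : open (V `&` cdom (chart_at M x)) by apply: openI => //; exact: cdom_open.
  exact: leq_rank_near oVc (conj Vx (chart_at_dom x)) Ohr.
(* The ranks of the [h i] are already constant on [W1]; a point of [W1] where [B] has maximal rank
   makes the rank of [rho] locally constant as well. *)
have [||x [W1x nx]] := lower_semicontinuous_max
    (f := fun x => \rank (B x)) (b := n) oW1 W10.
- by move=> x _; exact: rank_leq_col.
- move=> x /W1V Vx; have nV := open_nbhs_nbhs (conj oV Vx).
  apply: filterS3 (near_hr x Vx) (near_c x) nV => y le1 cy Vy.
  exact: leq_trans le1 (hr_le x y Vy cy).
have Vx := W1V _ W1x.
have [W [oW Wx WP]] := near_open (filterI (filterI nx (near_hr x Vx))
  (filterI (near_c x) (open_nbhs_nbhs (conj oW1 W1x)))).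
have WW1 : W `<=` W1 by move=> y /WP[_ []].
have WV := subset_trans WW1 W1V.
have WU := subset_trans WV VU.
have Wc y : W y -> cdom (chart_at M x) y by move=> /WP[_ []].
have rB y : W y -> \rank (B y) = \rank (B x) by move=> /WP[[]].
have rhr y : W y -> \rank (hr x y) = \rank (B x).
  move=> Wy; have [[_ le1] _] := WP y Wy; apply/eqP.
  by rewrite eqn_leq le1 andbT -(rB y Wy) hr_le //; [exact: WV | exact: Wc].
(* [q i] is the rank at [x] of the map leaving the bundle of index [i]: [rho] for 0, [res_d j] for
   [j.+1]. *)
pose q i := if i is j.+1 then \rank (h j x) else \rank (B x).
exists W, (q 0%N); split=> //; first by exists x.
- apply: (@alternating_rank L (fun i => rk (res_E E i)) q) => [k kL|]; last first.
    (* The bundle of index [L] has rank 0, so the matrix of the map leaving it has no rows and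
       [q L = 0]. *)
    have := lenE L (leqnn L); rewrite /q; case: (L) => [|l] r0.
      by apply/eqP; rewrite -leqn0; apply: leq_trans (rank_leq_row _) _; rewrite r0.
    by apply/eqP; rewrite -leqn0; apply: leq_trans (rank_leq_row _) _; rewrite r0.
  have Wa i : (i <= L)%N -> W `<=` tdom (a i).
    by move=> iL; exact: subset_trans WV (Va iL).
  case: k kL => [|k] kL /=.
    rewrite -(rhr x Wx).
    apply: (@exact_rank U _ _ (res_d E 0) W (a 0) (a 1) (h 0) _ (hr x) (\rank (B x)))
      => //.
    + exact: res_bundle.
    + exact: res_bundle.
    + exact: Wa.
    + exact: Wa.
    + exact: mx_sheaf_subset WV (Oh 0%N kL).
    + by move=> y Wy; apply: hE => //; exact: WV.
    + have [Ohr _] := hrP x; apply: mx_sheaf_subset Ohr.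
      by move=> y Wy; split; [exact: WV | exact: Wc].
    move=> V' s oV' V'W ss.
    apply: (iff_trans _ (@res_exact_rho _ _ _ _ _ _ E V' s oV' _ ss)); last first.
      exact: subset_trans V'W WU.
    split=> H y V'y; have Wy := V'W _ V'y; have Vy := WV _ Wy; have cy := Wc _ Wy.
      rewrite BE //; apply: (@mulmx_rank_cancel _ _ _ _ _ (T x y)).
        by rewrite -hrT // rhr // rB.
      by rewrite -hrT //; exact: H.
    by rewrite hrT // mulmxA -BE // H // mul0mx.
  have [r rh] := hW1 k (ltnW kL).
  apply: (@exact_rank U _ _ (res_d E k.+1) W (a k.+1) (a k.+2) (h k.+1) _ (h k) r)
      => //.
  + exact: res_bundle.
  + exact: res_bundle.
  + by apply: Wa; exact: ltnW.
  + exact: Wa.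
  + exact: mx_sheaf_subset WV (Oh k.+1 kL).
  + by move=> y Wy; apply: hE => //; exact: WV.
  + exact: mx_sheaf_subset WV (Oh k (ltnW kL)).
  + by move=> y /WW1; exact: rh.
  move=> V' s oV' V'W ss.
  apply: (iff_trans _ (@res_exact_d _ _ _ _ _ _ E k V' s oV' _ ss)); last first.
    exact: subset_trans V'W WU.
  split=> H y V'y; have Wy := V'W _ V'y; have Vy := WV _ Wy.
    apply: (triv_inj (res_bundle E k) (a := a k)); [exact: WU | | ].
      by apply: Wa => //; exact: ltnW (ltnW kL).
    rewrite hE ?H //; last exact: ltnW.
    (* Linearity with scalar -1 at the vectors 0 and 0 shows that the trivialization sends 0 to
       0. *)
    have := triv_linear (res_bundle E k) (WU _ Wy) (Wa k (ltnW (ltnW kL)) _ Wy).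
    by move=> /(_ (-1) 0 0); rewrite scaler0 addr0 scaleN1r addNr.
  rewrite -hE ?H //; last exact: ltnW.
  have := triv_linear (res_bundle E k) (WU _ Wy) (Wa k (ltnW (ltnW kL)) _ Wy).
  by move=> /(_ (-1) 0 0); rewrite scaler0 addr0 scaleN1r addNr.
move=> y Wy; rewrite (fol_at_rho BE (WV _ Wy)) /= -(rB y Wy).
exists (row_base (B y)); rewrite row_base_free; split=> //.
by apply/seteqP; split=> v /=; rewrite eq_row_base.
Qed.

End Local.
End Generic.

(** * Generic dimension, connectedness and regular leaves *)

Section GenericRank.
Variables (R : realType) (g : geometry) (n : nat) (M : manifold R g n).
Local Notation K := (scalars R g).
Variable F : set M -> set (M -> 'rV[K]_n).
Implicit Types (U V W : set M).

(** Only the bundles of index at most [L] must be trivialized, so finitely many trivializing open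
    sets around one point of [V] are intersected. *)
Lemma generic_rank U (E : geometric_resolution F U) (L : nat) V :
  singular_foliation F -> open V -> V !=set0 -> V `<=` U -> length_le E L ->
  exists W r, [/\ open W, W !=set0, W `<=` V,
    r%:Z = \sum_(i < L) (-1) ^+ i * (rk (res_E E i))%:Z
    & forall x, W x -> has_dim (fol_at F x) r].
Proof.
move=> singF oV [x Vx] VU lenE.
have exa i : exists a : tindex (res_E E i), tdom a x.
  by have [_ cov _ _] := res_bundle E i; exact: cov (VU _ Vx).
pose a i := projT1 (cid (exa i)).
have na : \forall y \near x, forall i : 'I_L.+1, tdom (a i) y.
  apply: filter_forall => i; have [otd _ _ _] := res_bundle E i.
  exact: open_nbhs_nbhs (conj (otd (a i)) (projT2 (cid (exa i)))).
have [V' [oV' V'x V'P]] := near_open (filterI na (open_nbhs_nbhs (conj oV Vx))).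
have V'V : V' `<=` V by move=> y /V'P[].
have V'a i : (i <= L)%N -> V' `<=` tdom (a i).
  by rewrite -ltnS => iL y /V'P[/(_ (Ordinal iL))].
have [|W [r [oW W0 WV' rE Wr]]] :=
  generic_rank_triv singF oV' (subset_trans V'V VU) V'a _ lenE; first by exists x.
by exists W, r; split=> //; exact: subset_trans WV' V'V.
Qed.

(** For open [U]: the points where [F] has dimension [r] have an interior that is dense in [U]. *)
Definition generic_dim U (r : nat) : Prop :=
  forall V, open V -> V !=set0 -> V `<=` U ->
  exists W, [/\ open W, W !=set0, W `<=` V &
    forall x, W x -> has_dim (fol_at F x) r].

Lemma generic_dim_unique U U' r r' : open U -> open U' -> U `&` U' !=set0 ->
  generic_dim U r -> generic_dim U' r' -> r = r'.
Proof.
move=> oU oU' UU' Ur U'r'.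
have [W [oW W0 WU Wr]] := Ur _ (openI oU oU') UU' (@subIsetl _ _ _).
have [W' [_ [x W'x] W'W Wr']] := U'r' _ oW W0 (subset_trans WU (@subIsetr _ _ _)).
exact: has_dim_unique (Wr x (W'W x W'x)) (Wr' x W'x).
Qed.

(** The alternating sum does not depend on the open subset, so the dimensions found in the various
    [V] coincide. *)
Lemma generic_dim_resolution U (E : geometric_resolution F U) (L : nat) :
  singular_foliation F -> open U -> U !=set0 -> length_le E L ->
  exists r : nat, r%:Z = \sum_(i < L) (-1) ^+ i * (rk (res_E E i))%:Z /\
    generic_dim U r.
Proof.
move=> singF oU U0 lenE.
have [_ [r [_ _ _ rE _]]] := generic_rank singF oU U0 (@subset_refl _ _) lenE.
exists r; split=> // V oV V0 VU.
have [W [r' [oW W0 WV r'E Wr]]] := generic_rank singF oV V0 VU lenE.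
exists W; split=> //.
by have -> : r = r' by apply/eqP; rewrite -eqz_nat rE r'E.
Qed.

(** The sets [A s] are open and cover [M], and [generic_dim_unique] makes them disjoint; hence [A r]
    is also closed. *)
Lemma generic_dim_connected : connected [set: M] ->
  (forall m : M, exists U r, [/\ open U, U m & generic_dim U r]) ->
  exists r, forall m : M, exists U, [/\ open U, U m & generic_dim U r].
Proof.
move=> cM ex.
(* An empty [M] counts as connected here; any value serves, and 0 is taken. *)
have [[m0 _]|/set0P/negP/negPn/eqP M0] := pselect ([set: M] !=set0); last first.
  by exists 0%N => m; have : [set: M] m by []; rewrite M0.
have [U0 [r [oU0 U0m0 U0r]]] := ex m0.
pose A s := [set m : M | exists U, [/\ open U, U m & generic_dim U s]].
have oA (s : nat) : open (A s).
  rewrite openE => m [U [oU Um Us]].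
  apply: filterS (open_nbhs_nbhs (conj oU Um)) => y Uy.
  by exists U; split.
exists r => m.
suff AT : A r = [set: M] by have : A r m by rewrite AT.
apply: cM; first by exists m0, U0.
  by exists (A r); rewrite ?setTI.
exists (A r); last by rewrite setTI.
have -> : A r = ~` (\bigcup_(s in [set s | s <> r]) A s).
  apply/seteqP; split=> [y [U [oU Uy Ur]] [s /= sr [U' [oU' U'y U's]]]|y /= Ay].
    apply: sr; apply: generic_dim_unique U's Ur => //.
    by exists y.
  have [U [s [oU Uy Us]]] := ex y.
  have [<-|/eqP sr] := eqVneq s r; first by exists U; split.
  by exfalso; apply: Ay; exists s => //; exists U; split.
by apply/open_closedC/bigcup_open => s _; exact: oA.
Qed.

(** The dimension of [F] at [i y] is [k], because the injective tangent map has [fol_at F (i y)] as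
    its range. Regularity carries it to nearby generic points, where it is [r]. *)
Lemma regular_leaf_dim k (N : manifold R g k) (i : N -> M) y U r :
  integral_submanifold F i -> regular_point F (i y) ->
  open U -> U (i y) -> generic_dim U r -> k = r.
Proof.
move=> [_ _ _ inj_i range_i] [r' [V [oV Vy Vr]]] oU Uy Ur.
have [W [_ [x Wx] WVU Wr]] := Ur (U `&` V) (openI oU oV)
  (ex_intro _ _ (conj Uy Vy)) (@subIsetl _ _ _).
have <- : r' = r.
  by apply: has_dim_unique (Vr x _) (Wr x Wx); have [] := WVU x Wx.
apply: has_dim_unique (Vr _ Vy).
pose T := lin1_mx ('d (cmap (chart_at M (i y)) \o i \o cinv (chart_at N y))
  (cmap (chart_at N y) y)).
have TE v : tangent_map i y v = v *m T by rewrite mul_rV_lin1.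
exists T; split; last first.
  rewrite -range_i; apply/seteqP; split=> [_ [v _ <-]|v /= /submxP[u ->]] /=.
    by rewrite TE submxMl.
  by exists u; rewrite ?TE.
apply: inj_row_free => v vT; apply: (inj_i y); rewrite TE vT.
by rewrite /tangent_map raddf0.
Qed.

End GenericRank.

Theorem proposition2p5 (R : realType) (g : geometry) (n : nat)
    (M : manifold R g n) (F : set M -> set (M -> 'rV[scalars R g]_n)) :
  connected [set: M] ->
  singular_foliation F ->
  (forall m : M, exists U : set M, [/\ open U, U m &
     exists E : geometric_resolution F U, finite_length E]) ->
  exists r : nat,
    (forall (k : nat) (N : manifold R g k) (i : N -> M),
       regular_leaf F i -> k = r) /\
    (forall (U : set M) (E : geometric_resolution F U) (L : nat),
       open U -> U !=set0 -> length_le E L ->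
       r%:Z = \sum_(i < L) (-1) ^+ i * (rk (res_E E i))%:Z).
Proof.
move=> cM singF res.
have ex m : exists U r, [/\ open U, U m & generic_dim F U r].
  have [U [oU Um [E [L lenE]]]] := res m.
  have [|r [_ Ur]] := generic_dim_resolution singF oU _ lenE; first by exists m.
  by exists U, r.
have [r rP] := generic_dim_connected cM ex.
exists r; split=> [k N i [[subN _] [y regy]]|U E L oU [x Ux] lenE].
  have [U [oU Uy Ur]] := rP (i y).
  exact: regular_leaf_dim subN regy oU Uy Ur.
have U0 : U !=set0 by exists x.
have [r' [<- Ur']] := generic_dim_resolution singF oU U0 lenE.
have [U' [oU' U'x U'r]] := rP x.
(* The neighborhood [U'] of [x] and the domain [U] of the resolution overlap at [x], so their
   generic dimensions agree. *)
congr Posz; apply: generic_dim_unique oU' oU _ U'r Ur'.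
by exists x.
Qed.
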